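(* Let $k\ge 2$ and $r$ be integers with $1\le r\le k$, and suppose that $k=nd$ and $r=md$ for some positive integers $n$, $m$ and $d$. Then $$|\mathcal{P}_n(r,k)|=\frac{|\mathcal{A}_n(r,k)|}{n}=\frac{1}{n}\sum_{s\mid (n,m)}\binom{n/s}{m/s}\mu(s),$$ where the sum is taken over all positive divisors $s$ of the greatest common divisor $(n,m)$. In particular, $$|\mathcal{P}_k(r,k)|=\frac{|\mathcal{A}_k(r,k)|}{k}=\frac{1}{k}\sum_{s\mid (k,r)}\binom{k/s}{r/s}\mu(s).$$
   Context: For a finite set $A$ of nonnegative integers and a positive integer $i$, let $\overline{A}(i)\subseteq\{0,1,\ldots,i-1\}$ be the set of residues modulo $i$ of the elements of $A$; two finite sets $A,B$ are called equal modulo $i$ if $\overline{A}(i)=\overline{B}(i)$. Write $A+t=\{a+t: a\in A\}$. For integers $1\le j\le i$, $\mathcal{A}(j,i)$ denotes the collection of all subsets of $\{0,1,\ldots,i-1\}$ with exactly $j$ elements. For $A\in\mathcal{A}(j,i)$, $f_i(A)$ denotes the smallest positive integer $l$ such that $A$ equals $A+l$ modulo $i$ (it exists and is at most $i$). For $1\le s\le i$, $\mathcal{A}_s(j,i)=\{A\in\mathcal{A}(j,i): f_i(A)=s\}$. Two sets $A,A'\in\mathcal{A}_n(r,k)$ are called $k$-equivalent if there exists $j\in\{0,1,\ldots,k-1\}$ such that $A+j$ equals $A'$ modulo $k$; this is an equivalence relation, and $\mathcal{P}_n(r,k)$ denotes the set of its equivalence classes in $\mathcal{A}_n(r,k)$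 (called $(r,k)$-periods with length $n$). $(x,y)$ denotes the greatest common divisor, $|\cdot|$ cardinality, and $\mu$ the Möbius function. *)

(* Defs.v *)
From mathcomp Require Import all_boot all_order all_algebra finmap.

Set Implicit Arguments.
Unset Strict Implicit.
Unset Printing Implicit Defensive.

Definition residues (i : nat) (A : {fset nat}) : {set 'I_i} :=
  [set x : 'I_i | val x \in [fset (a %% i)%N | a in A]%fset].

Definition equal_mod (i : nat) (A B : {fset nat}) : bool :=
  residues i A == residues i B.

Definition translate (A : {fset nat}) (t : nat) : {fset nat} :=
  [fset (a + t)%N | a in A]%fset.

(* A subset of {0, ..., i - 1} is an element of [{set 'I_i}]; [nats] views it
   as a finite set of nonnegative integers, so that it can be translated
   without wrapping around. *)
Definition nats (i : nat) (A : {set 'I_i}) : {fset nat} :=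
  [fset val x | x in A]%fset.

Definition subsets (j i : nat) : {set {set 'I_i}} :=
  [set A : {set 'I_i} | #|A| == j].

(* The smallest positive l such that A equals A + l modulo i. The search may be
   restricted to 1 <= l <= i, since l = i always qualifies when 0 < i; see
   [shift_periodP]. *)
Definition shift_period (i : nat) (A : {set 'I_i}) : nat :=
  (find (fun l => equal_mod i (nats A) (translate (nats A) l)) (iota 1 i)).+1.

Lemma shift_periodP (i : nat) (A : {set 'I_i}) : (0 < i)%N ->
  [/\ (0 < shift_period A <= i)%N,
      equal_mod i (nats A) (translate (nats A) (shift_period A))
    & forall l, (0 < l)%N -> equal_mod i (nats A) (translate (nats A) l) ->
        (shift_period A <= l)%N].
Proof.
move=> i_gt0; rewrite /shift_period.
set P := fun l => equal_mod i (nats A) (translate (nats A) l).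
have Pi : P i.
  apply/eqP/setP => x; rewrite !inE; apply/imfsetP/imfsetP => -[a /= aA ->].
    by exists (a + i)%N; rewrite ?modnDr //; apply/imfsetP; exists a.
  by case/imfsetP: aA => b /= bA ->; exists b; rewrite // modnDr.
have hasP : has P (iota 1 i).
  by apply/hasP; exists i; rewrite // mem_iota i_gt0 add1n ltnSn.
have lt_fi : (find P (iota 1 i) < i)%N.
  by move: hasP; rewrite has_find size_iota.
split=> //.
  by have := nth_find 0 hasP; rewrite nth_iota // add1n.
case=> // l _ Pl; rewrite ltnS leqNgt; apply/negP => lt_lf.
have := before_find 0 lt_lf.
by rewrite nth_iota ?(ltn_trans lt_lf) // add1n; move: Pl; rewrite -/(P _) => ->.
Qed.

Definition subsets_of_period (s j i : nat) : {set {set 'I_i}} :=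
  [set A in subsets j i | shift_period A == s].

Definition equivalent (k : nat) : rel {set 'I_k} :=
  fun A A' => [exists j : 'I_k, equal_mod k (translate (nats A) j) (nats A')].

Definition periods (n r k : nat) : {set {set {set 'I_k}}} :=
  equivalence_partition (@equivalent k) (subsets_of_period n r k).

(* The Möbius function; the value at 0 is irrelevant. *)
Definition moebius (n : nat) : int :=
  if all (fun p => logn p n == 1%N) (primes n)
  then ((-1) ^+ size (primes n))%R else 0%R.

(* Main.v *)
Require Import Defs.
From mathcomp Require Import all_boot all_order all_algebra finmap.

(* For n | k, a subset of Z/k invariant under translation by n is the preimage
   of a subset of Z/n, and it is invariant under n exactly when its least
   period divides n. Counting the r-subsets invariant under n both ways gives
   binom(n, m) = sum_(s | n) |A_s(r, k)|, and Moebius inversion yields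
   |A_n(r, k)|. The translates of a set with least period n form an equivalence
   class with exactly n elements, whence |P_n(r, k)| = |A_n(r, k)| / n. *)

Set Implicit Arguments.
Unset Strict Implicit.
Unset Printing Implicit Defensive.

Import GRing.Theory Num.Theory.

(** * Divisor sums and Möbius inversion *)

(** Puts sums over the divisors of different numbers on one common index range, so that they can be
    exchanged or compared termwise. *)
Lemma big_divisors_dvd (V : nmodType) (n d : nat) (F : nat -> V) :
  (0 < n)%N -> (d %| n)%N ->
  (\sum_(s <- divisors d) F s = \sum_(s <- divisors n | (s %| d)%N) F s)%R.
Proof.
move=> n_gt0 dn; rewrite -[RHS]big_filter; apply/perm_big/uniq_perm.
- exact: divisors_uniq.
- exact/filter_uniq/divisors_uniq.
move=> s; rewrite mem_filter -!dvdn_divisors ?(dvdn_gt0 n_gt0 dn) //.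
by case sd: (s %| d)%N; rewrite //= (dvdn_trans sd dn).
Qed.

Lemma moebius_mul_prime (p t : nat) : prime p -> (0 < t)%N -> ~~ (p %| t)%N ->
  moebius (p * t) = (- moebius t)%R.
Proof.
move=> p_pr t_gt0 pt; have p_gt0 := prime_gt0 p_pr.
have primes_pt : perm_eq (primes (p * t)) (p :: primes t).
  apply: uniq_perm; first exact: primes_uniq.
    by rewrite /= mem_primes p_pr t_gt0 pt primes_uniq.
  by move=> q; rewrite primesM // primes_prime // !inE.
rewrite /moebius (perm_size primes_pt) (perm_all _ primes_pt) /=.
rewrite lognM // logn_prime // eqxx logn_coprime ?prime_coprime //=.
have -> : all (fun q => logn q (p * t) == 1) (primes t)
        = all (fun q => logn q t == 1) (primes t).
  apply: eq_in_all => q; rewrite mem_primes => /and3P[q_pr _ qt].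
  have /negPf q_neq_p : q != p by apply: contraNneq pt => <-.
  by rewrite lognM // logn_prime // q_neq_p.
by case: ifP => _; rewrite ?oppr0 // exprS mulN1r.
Qed.

Lemma moebius_sqr_dvd (p t : nat) : prime p -> (0 < t)%N -> (p %| t)%N ->
  moebius (p * t) = 0%R.
Proof.
move=> p_pr t_gt0 pt; have p_gt0 := prime_gt0 p_pr.
rewrite /moebius ifN //; apply/allPn; exists p.
  by rewrite mem_primes p_pr muln_gt0 p_gt0 t_gt0 dvdn_mulr.
rewrite lognM // logn_prime // eqxx.
by rewrite add1n eqSS -lt0n logn_gt0 mem_primes p_pr t_gt0.
Qed.

(* Among the divisors of n, the terms s and p * s with s prime to p cancel. *)
Lemma sum_moebius (n : nat) : (0 < n)%N ->
  (\sum_(s <- divisors n) moebius s = (n == 1%N)%:R)%R.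
Proof.
move=> n_gt0; case: (eqVneq n 1) => [-> | n_neq1].
  by rewrite /divisors /= big_seq1.
have p_pr : prime (pdiv n) by rewrite pdiv_prime // ltn_neqAle eq_sym n_neq1.
have pn := pdiv_dvd n; move: (pdiv n) p_pr pn => p p_pr pn.
have p_gt0 := prime_gt0 p_pr.
have q_gt0 : (0 < n %/ p)%N by rewrite divn_gt0 // dvdn_leq.
(* Multiples of [p] among the divisors of [n] are reindexed as [p * t] with [t] dividing
   [n %/ p]. *)
rewrite (bigID (fun s => p %| s)%N) /=.
have -> : (\sum_(s <- divisors n | (p %| s)%N) moebius s
           = \sum_(t <- divisors (n %/ p)) moebius (p * t))%R.
  rewrite -(big_map (muln p) xpredT) -[LHS]big_filter.
  apply/perm_big/uniq_perm.
  - exact/filter_uniq/divisors_uniq.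
  - rewrite map_inj_uniq ?divisors_uniq // => x y /eqP.
    by rewrite eqn_pmul2l // => /eqP.
  move=> s; rewrite mem_filter -dvdn_divisors //; apply/andP/mapP.
    case=> /dvdnP[t ->] tn; exists t; last exact: mulnC.
    by rewrite -dvdn_divisors // dvdn_divRL.
  case=> t; rewrite -dvdn_divisors // dvdn_divRL // mulnC => tn ->.
  by rewrite dvdn_mulr.
(* The terms with [p] dividing [t] vanish, since then [p * t] is divisible by the square of [p]. *)
rewrite (bigID (fun s => p %| s)%N) /=.
rewrite big1_seq ?add0r; last first.
  move=> t /andP[pt]; rewrite -dvdn_divisors // => tn.
  by rewrite moebius_sqr_dvd // (dvdn_gt0 q_gt0).
(* Both remaining sums are spread over all divisors of [n], so that they cancel term by term. *)
rewrite [X in (X + _)%R]big_mkcond /=.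
rewrite (big_divisors_dvd _ n_gt0 (dvdn_div pn)) /= [X in (_ + X)%R]big_mkcond.
rewrite [X in (X + _)%R]big_mkcond -big_split /= big1_seq // => s /=.
rewrite -dvdn_divisors // => sn; case: (boolP (p %| s)%N) => ps /=.
  by case: ifP.
rewrite dvdn_divRL // Gauss_dvd ?sn ?pn; last first.
  by rewrite coprime_sym prime_coprime.
by rewrite moebius_mul_prime ?(dvdn_gt0 n_gt0) // addNr.
Qed.

(** The right side is a sum over pairs with [s * t] dividing [n]. For fixed [t], the sum of
    [moebius s] over the divisors [s] of [n %/ t] vanishes unless [t = n]. *)
Lemma moebius_inversion (V : zmodType) (n : nat) (F a : nat -> V) :
    (0 < n)%N ->
    (forall t, (t %| n)%N -> F t = \sum_(s <- divisors t) a s)%R ->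
  (a n = \sum_(s <- divisors n) F (n %/ s)%N *~ moebius s)%R.
Proof.
move=> n_gt0 FE; symmetry.
transitivity (\sum_(s <- divisors n) \sum_(t <- divisors n | (s * t %| n)%N)
                a t *~ moebius s)%R.
  apply: eq_big_seq => s; rewrite -dvdn_divisors // => sn.
  rewrite FE ?dvdn_div // (big_divisors_dvd _ n_gt0 (dvdn_div sn)).
  rewrite mulrz_suml; apply: eq_bigl => t.
  by rewrite dvdn_divRL // mulnC.
under eq_bigr => s _ do rewrite big_mkcond.
rewrite exchange_big /=.
transitivity (\sum_(t <- divisors n) if t == n then a t else 0)%R.
  apply: eq_big_seq => t; rewrite -dvdn_divisors // => tn.
  have t_gt0 := dvdn_gt0 n_gt0 tn.
  have q_gt0 : (0 < n %/ t)%N by rewrite divn_gt0 // dvdn_leq.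
  rewrite -big_mkcond /= -mulrz_sumr.
  under eq_bigl => s do rewrite -dvdn_divRL //.
  rewrite -(big_divisors_dvd _ n_gt0 (dvdn_div tn)) sum_moebius //.
  by rewrite eq_sym eqn_div // mul1n; case: eqP.
rewrite (bigD1_seq n) ?divisors_uniq -?dvdn_divisors //= eqxx.
by rewrite big1 ?addr0 // => t /negPf ->.
Qed.

(** * Translation of subsets of Z/k, least periods and equivalence classes *)

Section Shift.

Variables (k : nat) (k_gt0 : (0 < k)%N).
Implicit Types (A B : {set 'I_k}) (i j l : nat).

(** The translation action on subsets of Z/k: equality modulo [k] becomes plain equality in
    [{set 'I_k}]. *)
Definition shift A j : {set 'I_k} := residues k (translate (nats A) j).

Lemma mem_shift A j (x : 'I_k) :
  reflect (exists2 a : 'I_k, a \in A & x = (a + j) %% k :> nat)%N (x \in shift A j).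
Proof.
rewrite /shift in_set; apply: (iffP (imfsetP _ _ _ _)) => /=.
  case=> _ /imfsetP[_ /imfsetP[a /= aA ->] ->] ->; by exists a.
case=> a aA ->; exists (a + j)%N => //.
by apply/imfsetP; exists (val a) => //; apply/imfsetP; exists a.
Qed.

Lemma residues_nats A : residues k (nats A) = A.
Proof.
apply/setP=> x; rewrite in_set; apply/imfsetP/idP => /=.
  case=> _ /imfsetP[a /= aA ->]; rewrite modn_small // => xa.
  by rewrite (val_inj xa).
move=> xA; exists (val x); last by rewrite modn_small ?ltn_ord.
by apply/imfsetP; exists x.
Qed.

Lemma shiftD A i j : shift A (i + j) = shift (shift A i) j.
Proof.
apply/setP=> x; apply/mem_shift/mem_shift; case=> a.
  move=> aA ->; exists (Ordinal (ltn_pmod (a + i) k_gt0)) => /=.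
    by apply/mem_shift; exists a.
  by rewrite modnDml addnA.
by case/mem_shift=> b bA -> ->; exists b => //; rewrite modnDml addnA.
Qed.

Lemma shift_mulk A i : shift A (i * k) = A.
Proof.
apply/setP=> x; apply/mem_shift/idP => [[a aA]|xA].
  by rewrite addnC modnMDl modn_small // => /val_inj->.
by exists x => //; rewrite addnC modnMDl modn_small.
Qed.

Lemma shift0 A : shift A 0 = A.
Proof. by rewrite -[in LHS](mul0n k) shift_mulk. Qed.

Lemma shiftAC A i j : shift (shift A i) j = shift (shift A j) i.
Proof. by rewrite -!shiftD addnC. Qed.

(** The natural number [j * k - j] represents [-j] modulo [k]. *)
Lemma shiftK A j : shift (shift A j) (j * k - j) = A.
Proof. by rewrite -shiftD subnKC ?shift_mulk ?leq_pmulr. Qed.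

Lemma shift_inj j : injective (shift^~ j).
Proof. by move=> A B E; rewrite -(shiftK A j) E shiftK. Qed.

Lemma card_shift A j : #|shift A j| = #|A|.
Proof.
have le_shift B i : (#|shift B i| <= #|B|)%N.
  pose h (a : 'I_k) := Ordinal (ltn_pmod (a + i) k_gt0).
  apply: leq_trans (leq_imset_card h B); apply/subset_leq_card/subsetP => x.
  by case/mem_shift=> a aB xE; apply/imsetP; exists a => //; apply: val_inj.
(* The reverse inequality is [le_shift] for the inverse translation. *)
by apply/eqP; rewrite eqn_leq le_shift -{1}(shiftK A j) le_shift.
Qed.

Lemma shift_fixM A l i : shift A l = A -> shift A (i * l) = A.
Proof. by move=> Al; elim: i => [|i IHi]; rewrite ?shift0 // mulSn shiftD Al. Qed.

Lemma shift_periodE A :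
  [/\ (0 < shift_period A)%N, shift A (shift_period A) = A
    & forall l, (0 < l)%N -> shift A l = A -> (shift_period A <= l)%N].
Proof.
have [/andP[f_gt0 _] /eqP fA fmin] := shift_periodP A k_gt0.
split=> // [|l l_gt0 Al]; first by rewrite /shift -fA residues_nats.
by apply: fmin => //; rewrite /equal_mod residues_nats eq_sym; apply/eqP.
Qed.

(** If [l] fixes [A], so does its remainder modulo the least period; by minimality this remainder is
    0. *)
Lemma shift_fixP A l : reflect (shift A l = A) (shift_period A %| l)%N.
Proof.
have [f_gt0 fA fmin] := shift_periodE A.
apply: (iffP idP) => [/dvdnP[i ->] | Al]; first exact: shift_fixM.
rewrite /dvdn eqn0Ngt; apply/negP => lf_gt0.
have := ltn_pmod l f_gt0; rewrite ltnNge fmin //.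
rewrite -[RHS]Al [in RHS](divn_eq l (shift_period A)).
by rewrite [RHS]shiftD shift_fixM.
Qed.

(** Translations commute, so [A] and [shift A j] are fixed by the same translations and their
    periods divide each other. *)
Lemma shift_period_shift A j : shift_period (shift A j) = shift_period A.
Proof.
apply/eqP; rewrite eqn_dvd; apply/andP; split; apply/shift_fixP.
  by rewrite shiftAC; congr shift; apply/shift_fixP.
by apply: (@shift_inj j); rewrite shiftAC; apply/shift_fixP.
Qed.

Lemma equivalentP A B :
  reflect (exists j, B = shift A j) (equivalent A B).
Proof.
apply: (iffP existsP) => [[j]|[j ->]].
  by rewrite /equal_mod residues_nats => /eqP <-; exists (val j).
exists (Ordinal (ltn_pmod j k_gt0)); rewrite /equal_mod residues_nats /=.
by rewrite {2}(divn_eq j k) shiftD shift_mulk.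
Qed.

Lemma equivalent_equiv : equivalence_rel (@equivalent k).
Proof.
have eqv_sym A B : equivalent A B -> equivalent B A.
  case/equivalentP=> j ->; apply/equivalentP; exists (j * k - j)%N.
  by rewrite shiftK.
have eqv_trans A B C : equivalent A B -> equivalent B C -> equivalent A C.
  case/equivalentP=> i -> /equivalentP[j ->]; apply/equivalentP.
  by exists (i + j)%N; rewrite shiftD.
move=> A B C; split; first by apply/equivalentP; exists 0%N; rewrite shift0.
by move=> AB; apply/idP/idP; apply: eqv_trans => //; apply: eqv_sym.
Qed.

(** The map sending [j] to [shift A j] is a bijection from ['I_n] onto the class of [A]. *)
Lemma card_equivalent_class (n r : nat) A : A \in subsets_of_period n r k ->
  #|[set B in subsets_of_period n r k | equivalent A B]| = n.
Proof.
rewrite !inE => /andP[/eqP cardA /eqP perA].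
have [n_gt0 An _] := shift_periodE A; rewrite perA in n_gt0 An.
rewrite -[RHS]card_ord -(card_imset predT (f := fun j : 'I_n => shift A j)).
  apply: eq_card => B; rewrite !inE; apply/andP/imsetP.
    case=> _ /equivalentP[j ->]; exists (Ordinal (ltn_pmod j n_gt0)) => //=.
    by rewrite {1}(divn_eq j n) shiftD shift_fixM.
  case=> j _ ->; rewrite card_shift cardA shift_period_shift perA !eqxx.
  by split=> //; apply/equivalentP; exists (val j).
suff inj_le (i j : 'I_n) : (i <= j)%N -> shift A i = shift A j -> i = j.
  by move=> i j; case/orP: (leq_total i j) => ij E;
     [|symmetry]; apply: inj_le.
(* Cancelling the translation by [i] shows that [n] divides [j - i], which is less than [n]. *)
move=> le_ij; rewrite -(subnK le_ij) shiftD => /shift_inj/esym/shift_fixP.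
rewrite perA => n_dvd; apply/val_inj/eqP; rewrite /= eqn_leq le_ij -subn_eq0 /=.
apply: contraTT n_dvd => ?; rewrite gtnNdvd ?lt0n //.
by apply: leq_ltn_trans (ltn_ord j); apply: leq_subr.
Qed.

Lemma card_periods (n r : nat) :
  #|subsets_of_period n r k| = (#|periods n r k| * n)%N.
Proof.
apply: card_uniform_partition (equivalence_partitionP _); last first.
  by move=> A B C _ _ _; apply: equivalent_equiv.
by move=> _ /imsetP[A AD ->]; apply: card_equivalent_class.
Qed.

(** A set is fixed by [n] exactly when its least period divides [n], so it is counted once, at that
    divisor. *)
Lemma card_shift_fix (n r : nat) : (0 < n)%N ->
  #|[set A in subsets r k | shift A n == A]|
  = (\sum_(s <- divisors n) #|subsets_of_period s r k|)%N.
Proof.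
move=> n_gt0; rewrite -sum1_card.
under [RHS]eq_bigr => s _ do rewrite -sum1_card big_mkcond.
rewrite exchange_big big_mkcond /=; apply: eq_bigr => A _.
rewrite -big_mkcond /= !inE.
have -> : (shift A n == A) = (shift_period A \in divisors n).
  by rewrite -dvdn_divisors //; apply/eqP/shift_fixP.
case: (boolP (#|A| == r)) => Ar /=; last first.
  by rewrite big1 // => s; rewrite !inE (negPf Ar).
rewrite (eq_bigl (pred1 (shift_period A))); last first.
  by move=> s; rewrite !inE Ar eq_sym.
rewrite sum1_count count_uniq_mem ?divisors_uniq //.
Qed.

End Shift.

(** * Invariant subsets of Z/nd as preimages of subsets of Z/n *)

Section Pullback.

Variables (n d : nat) (n_gt0 : (0 < n)%N) (d_gt0 : (0 < d)%N).
Implicit Type B : {set 'I_n}.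

Definition reduce (x : 'I_(n * d)) : 'I_n := Ordinal (ltn_pmod x n_gt0).

Definition pullback B : {set 'I_(n * d)} := reduce @^-1: B.

Let nd_gt0 : (0 < n * d)%N. Proof. by rewrite muln_gt0 n_gt0. Qed.

(** The numbers [q * n + y] with [q < d] are the elements of the fibre of [reduce] over [y]. *)
Lemma lift_subproof (y : 'I_n) (q : 'I_d) : (q * n + y < n * d)%N.
Proof.
apply: leq_trans (_ : q.+1 * n <= _)%N.
  by rewrite mulSn addnC ltn_add2r.
by rewrite mulnC leq_pmul2l.
Qed.

Lemma card_pullback B : #|pullback B| = (#|B| * d)%N.
Proof.
pose h (u : 'I_n * 'I_d) := Ordinal (lift_subproof u.1 u.2).
rewrite -[d in RHS]card_ord -cardsT -cardsX -(card_imset _ (f := h)).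
  apply: eq_card => x; rewrite inE; apply/idP/imsetP => [xB | [[y q]]].
    have x_div : (x %/ n < d)%N by rewrite ltn_divLR // [(d * n)%N]mulnC.
    exists (reduce x, Ordinal x_div); first by rewrite !inE xB.
    by apply: val_inj; rewrite /= -divn_eq.
  rewrite !inE andbT /= => yB ->; rewrite (_ : reduce _ = y) //.
  by apply: val_inj; rewrite /= modnMDl modn_small.
move=> [y q] [y' q'] /(congr1 val) /= E.
have Ey : val y = val y'.
  by have := congr1 (modn^~ n) E; rewrite /= !modnMDl !modn_small.
move/eqP: E; rewrite Ey eqn_add2r eqn_pmul2r // => /eqP Eq.
by rewrite (val_inj Ey) (val_inj Eq).
Qed.

Lemma pullback_inj : injective pullback.
Proof.
(* Membership is tested at the lift of [y] with [q = 0], where [Ordinal d_gt0] is the zero of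
   ['I_d]. *)
move=> B C E; apply/setP=> y; have := congr1 (fun D : {set _} =>
  Ordinal (lift_subproof y (Ordinal d_gt0)) \in D) E.
rewrite !inE (_ : reduce _ = y) //.
by apply: val_inj; rewrite /= modnMDl modn_small.
Qed.

Lemma shift_fix_pullback (A : {set 'I_(n * d)}) :
  (shift A n == A) = (A \in pullback @: setT).
Proof.
apply/eqP/imsetP => [An | [B _ ->]]; last first.
  (* Translation preserves cardinality, so one inclusion suffices. *)
  apply/eqP; rewrite eqEcard card_shift // leqnn andbT.
  apply/subsetP => x /mem_shift[a]; rewrite !inE => aB xE.
  rewrite (_ : reduce x = reduce a) //; apply: val_inj.
  by rewrite /= xE modn_dvdm ?dvdn_mulr // modnDr.
(* [base y] is the representative of [y] below [n]; the set [B] sought is the trace of [A] on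
   these. *)
pose base (y : 'I_n) := Ordinal (lift_subproof y (Ordinal d_gt0)).
exists (base @^-1: A) => //; apply/setP=> x; rewrite !inE.
have x_div : (x %/ n <= d)%N by rewrite ltnW // ltn_divLR // [(d * n)%N]mulnC.
apply/idP/idP => [xA | yA].
  (* Adding [d - x %/ n] further multiples of [n] to [x] gives [x %% n + d * n], which wraps around
     to [x %% n]. *)
  rewrite -(shift_fixM nd_gt0 (d - x %/ n) An); apply/mem_shift; exists x => //.
  rewrite /= mul0n add0n {2}(divn_eq x n) addnAC -mulnDl subnKC //.
  rewrite [(d * n)%N]mulnC modnDl [RHS]modn_small //.
  by apply: leq_trans (ltn_pmod _ n_gt0) _; rewrite leq_pmulr.
rewrite -(shift_fixM nd_gt0 (x %/ n) An); apply/mem_shift.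
exists (base (reduce x)) => //=.
by rewrite mul0n add0n addnC -divn_eq modn_small.
Qed.

Lemma card_shift_fix_binomial (r : nat) :
  #|[set A in subsets r (n * d) | shift A n == A]|
  = (if (d %| r)%N then 'C(n, r %/ d) else 0%N).
Proof.
transitivity #|[set B : {set 'I_n} | #|B| * d == r]%N|.
  rewrite -(card_imset _ pullback_inj); apply: eq_card => A.
  rewrite !inE shift_fix_pullback; apply/andP/imsetP.
    case=> /eqP <- /imsetP[B _ ->]; exists B => //.
    by rewrite inE card_pullback.
  case=> B; rewrite inE => /eqP Br ->.
  by rewrite card_pullback Br imset_f.
case: ifP => [/dvdnP[m ->] | ndr].
  (* With [r = m * d], the condition on [B] is that it has [m] elements. *)
  rewrite mulnK // -[n in RHS]card_ord -card_draws; apply: eq_card => B.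
  by rewrite !inE eqn_pmul2r.
apply: eq_card0 => B; rewrite !inE; apply/negP => /eqP Br.
by rewrite -Br dvdn_mull in ndr.
Qed.

End Pullback.

(** * The formula for the number of sets of given period, and the theorem *)

Lemma card_subsets_of_period (n m d : nat) :
    (0 < n)%N -> (0 < d)%N ->
  (#|subsets_of_period n (m * d) (n * d)|%:R
   = \sum_(s <- divisors (gcdn n m))
       'C(n %/ s, m %/ s)%:R * (moebius s)%:~R :> rat)%R.
Proof.
move=> n_gt0 d_gt0; have nd_gt0 : (0 < n * d)%N by rewrite muln_gt0 n_gt0.
pose F t : rat := (#|[set A in subsets (m * d) (n * d) | shift A t == A]|%:R)%R.
pose a s : rat := (#|subsets_of_period s (m * d) (n * d)|%:R)%R.
have FE t : (t %| n)%N -> (F t = \sum_(s <- divisors t) a s)%R.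
  by move=> tn; rewrite /F /a -natr_sum -card_shift_fix ?(dvdn_gt0 n_gt0 tn).
rewrite -[LHS]/(a n) (moebius_inversion n_gt0 FE).
rewrite [RHS](big_divisors_dvd _ n_gt0 (dvdn_gcdl n m)) [RHS]big_mkcond /=.
apply: eq_big_seq => s; rewrite -dvdn_divisors // => sn.
have s_gt0 := dvdn_gt0 n_gt0 sn.
have q_gt0 : (0 < n %/ s)%N by rewrite divn_gt0 // dvdn_leq.
have sd_gt0 : (0 < s * d)%N by rewrite muln_gt0 s_gt0.
(* The binomial count is applied with modulus [n %/ s] and fibres of size [s * d]. Its condition
   that [s * d] divides [m * d] means that [s] divides [m], which cuts the divisors of [n] down to
   those of [gcdn n m]. *)
have nE : (n * d = n %/ s * (s * d))%N by rewrite mulnA divnK.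
rewrite dvdn_gcd sn /= /F nE card_shift_fix_binomial //.
rewrite dvdn_pmul2r // divnMr //.
by case: ifP => _; rewrite ?mul0rz // -mulrzr.
Qed.

Local Open Scope ring_scope.

Theorem theorem1 (k r : nat) (hk : (2 <= k)%N) (hr : (1 <= r <= k)%N) :
  (forall n m d : nat,
     (0 < n)%N -> (0 < m)%N -> (0 < d)%N -> k = (n * d)%N -> r = (m * d)%N ->
     #|periods n r k|%:R = #|subsets_of_period n r k|%:R / n%:R :> rat
     /\ #|subsets_of_period n r k|%:R / n%:R
        = n%:R^-1 * (\sum_(s <- divisors (gcdn n m))
                       'C(n %/ s, m %/ s)%:R * (moebius s)%:~R) :> rat)
  /\ (#|periods k r k|%:R = #|subsets_of_period k r k|%:R / k%:R :> rat
      /\ #|subsets_of_period k r k|%:R / k%:R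
         = k%:R^-1 * (\sum_(s <- divisors (gcdn k r))
                        'C(k %/ s, r %/ s)%:R * (moebius s)%:~R) :> rat).
Proof.
have k_gt0 : (0 < k)%N := ltnW hk.
have [r_gt0 _] := andP hr.
suff main n m d : (0 < n)%N -> (0 < m)%N -> (0 < d)%N ->
    k = (n * d)%N -> r = (m * d)%N ->
    #|periods n r k|%:R = #|subsets_of_period n r k|%:R / n%:R :> rat
    /\ #|subsets_of_period n r k|%:R / n%:R
       = n%:R^-1 * (\sum_(s <- divisors (gcdn n m))
                      'C(n %/ s, m %/ s)%:R * (moebius s)%:~R) :> rat.
  (* The particular case is [d = 1], with [n = k] and [m = r]. *)
  by split=> //; apply: (main k r 1%N); rewrite ?muln1.
move=> n_gt0 _ d_gt0 kE rE; split.
  by rewrite card_periods // natrM mulfK // pnatr_eq0 -lt0n.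
by rewrite mulrC kE rE card_subsets_of_period.
Qed.
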